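(* Let $P_1,\dots,P_m$ be nonzero univariate complex polynomials of degrees $k_1,\dots,k_m\ge1$. Then $$\|P_1\|\cdots\|P_m\|\le\min\Big\{\sqrt{\frac{(k_1+\dots+k_m)!}{k_1!\cdots k_m!}},\ \sqrt{\frac{e^{k_1+\dots+k_m}}{k_1+\dots+k_m+1}}\Big\}\,\|P_1\cdots P_m\|,$$ where $\|\cdot\|$ is the Bombieri–Weyl norm.
   Context: The Bombieri–Weyl norm of a univariate polynomial $P(z)=\sum_{i=0}^k a_iz^i$ of degree $k$ is $\|P\|=(\sum_{i=0}^k\binom{k}{i}^{-1}|a_i|^2)^{1/2}$, i.e. the norm of its homogenization $\sum a_ix^iy^{k-i}$. *)

(* Defs.v *)
From Stdlib Require Import Reals List Arith.
Open Scope R_scope.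

Definition Cpx : Type := (R * R)%type.
Definition Czero : Cpx := (0, 0).
Definition Cone : Cpx := (1, 0).
Definition Cadd (z w : Cpx) : Cpx := (fst z + fst w, snd z + snd w).
Definition Cmul (z w : Cpx) : Cpx :=
  (fst z * fst w - snd z * snd w, fst z * snd w + snd z * fst w).
Definition Cnorm2 (z : Cpx) : R := fst z * fst z + snd z * snd z.

(* Univariate complex polynomials: little-endian coefficient lists,
   p = [a_0; a_1; ...; a_k] represents sum a_i z^i. *)
Definition cpoly : Type := list Cpx.
Definition coef (p : cpoly) (i : nat) : Cpx := nth i p Czero.

Definition deg (p : cpoly) : nat := (length p - 1)%nat.
Definition has_nonzero_lead (p : cpoly) : Prop := p <> nil /\ last p Czero <> Czero.

Fixpoint Csum (f : nat -> Cpx) (n : nat) : Cpx :=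
  match n with O => Czero | S n' => Cadd (Csum f n') (f n') end.
Definition pmul (p q : cpoly) : cpoly :=
  map (fun n => Csum (fun i => Cmul (coef p i) (coef q (n - i))) (S n))
      (seq 0 (length p + length q - 1)).

Definition pprod (P : nat -> cpoly) (m : nat) : cpoly :=
  fold_right (fun i acc => pmul (P i) acc) (Cone :: nil) (seq 0 m).

Definition bw_norm (p : cpoly) : R :=
  sqrt (sum_f_R0 (fun i => Cnorm2 (coef p i) / Binomial.C (deg p) i) (deg p)).

Definition Rprod (f : nat -> R) (m : nat) : R :=
  fold_right (fun i acc => f i * acc) 1 (seq 0 m).
Definition nsum (f : nat -> nat) (m : nat) : nat :=
  fold_right (fun i acc => (f i + acc)%nat) 0%nat (seq 0 m).

(* Main.v *)
(** Write [p]^2 = sum_i i! (k-i)! |p_i|^2 = k! ||p||^2 (the Fischer norm). Normal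
    ordering of the operator conj(p)(D) p(x) exhibits [pq]^2 as a sum of squares in
    which the terms of top order add up to [p]^2 [q]^2; this gives the first bound.

    For the second bound, ||p|| is at most the product of the norms of the linear
    factors of p, so it suffices to bound from below the norm of
    p = c prod (z - r_j) of degree N. With t = u / (1 - u) one has
      ||p||^2 = (N+1) int_0^1 (1-u)^N (sum_i |p_i|^2 t^i) du,
    and Landau's inequality bounds the sum below by |c|^2 prod max(|r_j|^2, t).
    Since int_0^1 ln max(rho (1-u), u) du = ln (1 + rho) - 1, Jensen's inequality, in
    the form e^x >= 1 + x, yields
      ||p||^2 >= (N+1) e^{-N} |c|^2 prod (1 + |r_j|^2). *)

Require Import Defs.
From Stdlib Require Import Reals List Arith.
From Stdlib Require Lra.
From mathcomp Require all_boot all_order all_algebra.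
From mathcomp Require zify ring Rstruct complex.
From Coquelicot Require Coquelicot.
Open Scope R_scope.

Module LogIntegral.

Import Lra.
Import all_boot all_order all_algebra.
Import Rstruct.
Import Coquelicot.Coquelicot.
Set Implicit Arguments. Unset Strict Implicit. Unset Printing Implicit Defensive.
Import Order.TTheory GRing.Theory Num.Theory.
Local Open Scope R_scope.

(** * Integration from antiderivatives, and the Beta integrals *)

Lemma is_RInt_derive_eq (f df : R -> R) (a b v : R) : a <= b ->
  (forall x, a <= x <= b -> is_derive f x (df x)) ->
  (forall x, a <= x <= b -> continuous df x) ->
  f b - f a = v -> is_RInt df a b v.
Proof.
move=> leab fd dfc <-; apply: (is_RInt_derive f df a b);
  rewrite Rmin_left // Rmax_right //.
Qed.

(** Induction on [i]: the derivative of u^(i+1) (1-u)^(k+1) integrates to 0, which trades a power of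
    [1 - u] for a power of [u]. With i + k = N the value is 1 / ((N+1) C(N,i)), the Bombieri weight
    up to the factor N+1. *)
Lemma is_RInt_beta (i k : nat) :
  is_RInt (fun u => u ^ i * (1 - u) ^ k) 0 1
    (INR (fact i) * INR (fact k) / INR (fact (S (i + k)))).
Proof.
have ex_cont (i' k' : nat) (x : R) : continuous (fun u => u ^ i' * (1 - u) ^ k') x.
  by apply: ex_derive_continuous; auto_derive.
have factS n : INR (fact (S n)) = (INR n + 1) * INR (fact n).
  by rewrite fact_simpl mult_INR S_INR.
have pos n : INR n + 1 <> 0 by have := pos_INR n; lra.
elim: i k => [|i IH] k.
  apply: (@is_RInt_derive_eq (fun u => - (1 - u) ^ (S k) / (INR k + 1))); first lra.
  - move=> x _; auto_derive => //; rewrite -/(INR (S k)) S_INR /= -/(1 - x); field; exact: pos.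
  - by move=> x _; apply: ex_cont.
  - rewrite factS /=; have := INR_fact_neq_0 k; have := pos k.
    rewrite Rminus_diag Rmult_0_l => ? ?; rewrite Rminus_0_r pow1 add0n; by field.
have H := IH (S k).
have D : is_RInt (fun u => (INR i + 1) * (u ^ i * (1 - u) ^ (S k))
     - (INR k + 1) * (u ^ (S i) * (1 - u) ^ k)) 0 1 0.
  apply: (@is_RInt_derive_eq (fun u => u ^ (S i) * (1 - u) ^ (S k))); first lra.
  - move=> x _; auto_derive => //; rewrite -/(INR (S i)) -/(INR (S k)) !S_INR /= -/(1 - x); ring.
  - by move=> x _; apply: ex_derive_continuous; auto_derive.
  - by rewrite /=; ring.
have := is_RInt_scal _ _ _ (/ (INR k + 1)) _
  (is_RInt_minus _ _ _ _ _ _ (is_RInt_scal _ _ _ (INR i + 1) _ H) D).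
rewrite /scal /minus /plus /opp /= /mult /= => E.
have -> : INR (fact (S i)) * INR (fact k) / INR (fact (S (S i + k)))
  = / (INR k + 1) * ((INR i + 1) * (INR (fact i) * INR (fact (S k)) / INR (fact (S (i + S k)))) + - 0).
  rewrite !addSn !addnS !factS.
  by field; repeat split; first [exact: INR_fact_neq_0 | exact: pos].
apply: is_RInt_ext E => x _ /=; field; exact: pos.
Qed.

(** * The logarithmic integral of one root, and of a list of roots *)

(* With [u = |z|^2 / (1 + |z|^2)], the mean over a circle of
   [ln (|z - r|^2 / ((1 + |z|^2) (1 + |r|^2)))], where [rho = |r|^2]. *)
Definition log_chord (rho u : R) : R := ln (Rmax (rho * (1 - u)) u) - ln (1 + rho).

Lemma mul_ln_ge (x : R) : 0 < x -> x - 1 <= x * ln x.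
Proof.
move=> x0; have ix := Rinv_0_lt_compat x x0.
have h : - ln x <= / x - 1.
  by rewrite -ln_Rinv //; have := exp_ineq1_le (ln (/ x)); rewrite exp_ln //; lra.
have := Rmult_le_compat_l x _ _ (Rlt_le _ _ x0) h.
by rewrite Rmult_minus_distr_l Rinv_r; lra.
Qed.

Lemma ln_le0 (x : R) : 0 < x <= 1 -> ln x <= 0.
Proof. by move=> x01; rewrite -ln_1; apply: ln_le; lra. Qed.

Lemma is_RInt_ln (c a b : R) : 0 < a <= b ->
  is_RInt (fun u => ln u - c) a b ((b * ln b - b - c * b) - (a * ln a - a - c * a)).
Proof.
move=> ab; apply: (@is_RInt_derive_eq (fun u => u * ln u - u - c * u)); first lra.
- by move=> x xab; auto_derive; [lra | field; lra].
- by move=> x xab; apply: ex_derive_continuous; auto_derive; lra.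
- by [].
Qed.

Lemma is_RInt_ln_rev (rho c a b : R) : 0 < rho -> a <= b < 1 ->
  is_RInt (fun u => ln (rho * (1 - u)) - c) a b
    ((- (1 - b) * ln (rho * (1 - b)) - b - c * b)
     - (- (1 - a) * ln (rho * (1 - a)) - a - c * a)).
Proof.
move=> rho0 ab.
have pos x : a <= x <= b -> 0 < rho * (1 - x) by move=> ?; apply: Rmult_lt_0_compat; lra.
apply: (@is_RInt_derive_eq (fun u => - (1 - u) * ln (rho * (1 - u)) - u - c * u)); first lra.
- move=> x xab; have p := pos x xab; auto_derive; rewrite -?/(1 - x) //.
  by field; lra.
- by move=> x xab; have p := pos x xab; apply: ex_derive_continuous; auto_derive; rewrite -?/(1 - x).
- by [].
Qed.

Lemma is_RInt_eq_open (f g : R -> R) (a b v : R) : a <= b ->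
  is_RInt f a b v -> (forall x, a < x < b -> g x = f x) -> is_RInt g a b v.
Proof.
move=> leab fv fg; apply: is_RInt_ext fv => x.
by rewrite Rmin_left // Rmax_right // => /fg.
Qed.

(* The integral over the whole of [0, 1] is exactly -1; the integrand may be
   singular at the end points. *)
Lemma is_RInt_log_chord (rho : R) : 0 <= rho ->
  exists d, 0 < d /\ forall e, 0 < e < d ->
    exists2 v, is_RInt (log_chord rho) e (1 - e) v & -1 <= v.
Proof.
move=> rho0; have [<-|rho_gt0] : 0 = rho \/ 0 < rho by lra.
  exists (1 / 2); split; first lra; move=> e he.
  have le : 0 < e <= 1 - e by lra.
  eexists.
    apply: (is_RInt_eq_open _ (@is_RInt_ln (ln (1 + 0)) _ _ le)); first lra.
    move=> x hx.
    by rewrite /log_chord Rmax_right // Rmult_0_l; lra.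
  rewrite Rplus_0_r ln_1; have := @mul_ln_ge (1 - e); have := @ln_le0 e.
  nra.
(* [A] is the crossover point of the maximum, where rho (1 - u) = u. The threshold chosen for [e]
   below keeps [A] inside [e, 1 - e]. *)
set A := rho / (1 + rho).
have A01 : 0 < A < 1.
  split; first by apply: Rdiv_lt_0_compat; lra.
  by apply/Rlt_div_l; lra.
have rhoA : rho * (1 - A) = A by rewrite /A; field; lra.
have lnA : ln A = ln rho - ln (1 + rho) by rewrite /A ln_div; lra.
exists (Rmin A (1 - A)); split; first by apply: Rmin_glb_lt; lra.
move=> e [e0 /Rmin_Rgt_l [eA e1A]].
have le1 : e <= A < 1 by lra. have le2 : 0 < A <= 1 - e by lra.
eexists.
  apply: is_RInt_Chasles.
    apply: (is_RInt_eq_open _ (@is_RInt_ln_rev rho (ln (1 + rho)) _ _ rho_gt0 le1)); first lra.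
    move=> x hx; rewrite /log_chord Rmax_left //; have := rhoA; nra.
  apply: (is_RInt_eq_open _ (@is_RInt_ln (ln (1 + rho)) _ _ le2)); first lra.
  move=> x hx; rewrite /log_chord Rmax_right //; have := rhoA; nra.
(* The two pieces add up to 2 (1-e) ln (1-e) + 2 e - 1 + e (2 ln (1+rho) - ln rho). The last term is
   nonnegative, and (1-e) ln (1-e) >= -e by [mul_ln_ge]. *)
rewrite /plus /= rhoA ln_mult; try lra.
have h1 := @mul_ln_ge (1 - e); have h2 : ln rho <= ln (1 + rho) by apply: ln_le; lra.
have h3 : 0 <= ln (1 + rho) by rewrite -ln_1; apply: ln_le; lra.
rewrite lnA; nra.
Qed.

Lemma is_RInt_bigsum (n : nat) (f : nat -> R -> R) (v : nat -> R) (a b : R) :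
  (forall i, (i < n)%N -> is_RInt (f i) a b (v i)) ->
  is_RInt (fun u => (\sum_(i < n) f i u)%R) a b (\sum_(i < n) v i)%R.
Proof.
elim: n => [|n IH] fv.
  rewrite big_ord0; have := @is_RInt_const _ a b (0 : R).
  rewrite /scal /= /mult /= Rmult_0_r; apply: is_RInt_ext => x _.
  by rewrite big_ord0.
rewrite big_ord_recr /=; have := is_RInt_plus _ _ _ _ _ _
  (IH (fun i li => fv i (ltnW li))) (fv n (ltnSn n)).
by apply: is_RInt_ext => x _; rewrite big_ord_recr.
Qed.

Lemma is_RInt_sum_log_chord (s : seq R) : (forall rho, rho \in s -> 0 <= rho) ->
  exists d, 0 < d /\ forall e, 0 < e < d -> exists2 v,
    is_RInt (fun u => (\sum_(rho <- s) log_chord rho u)%R) e (1 - e) v & - INR (size s) <= v.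
Proof.
elim: s => [|rho s IH] s0.
  exists 1; split; first lra; move=> e _; exists 0; last by rewrite /=; lra.
  have := @is_RInt_const _ e (1 - e) (0 : R).
  rewrite /scal /= /mult /= Rmult_0_r; apply: is_RInt_ext => x _.
  by rewrite big_nil.
have [|d1 [d1_gt0 Hd1]] := @is_RInt_log_chord rho; first by apply: s0; rewrite mem_head.
have [|d2 [d2_gt0 Hd2]] := IH; first by move=> r rs; apply: s0; rewrite inE rs orbT.
exists (Rmin d1 d2); split; first exact: Rmin_glb_lt.
move=> e [e0 /Rmin_Rgt_l [e1 e2]].
have [v1 i1 h1] := Hd1 e (conj e0 e1); have [v2 i2 h2] := Hd2 e (conj e0 e2).
exists (v1 + v2); last by rewrite [size _]/= S_INR; lra.
apply: is_RInt_ext (is_RInt_plus _ _ _ _ _ _ i1 i2) => x _.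
by rewrite big_cons.
Qed.

(** * Jensen's inequality for the integrated lower bound *)

(** Each root yields one factor [1 - u], because max(rho (1-u), u) = (1-u) max(rho, u/(1-u)). This
    rewrites Landau's product at t = u/(1-u) as an exponential, ready for Jensen. *)
Lemma prod_exp_log_chord (s : seq R) (u : R) : (forall rho, rho \in s -> 0 <= rho) ->
  0 < u < 1 ->
  (\prod_(rho <- s) (1 + rho))%R * exp (\sum_(rho <- s) log_chord rho u)%R
  = (1 - u) ^ size s * (\prod_(rho <- s) Rmax rho (u / (1 - u)))%R.
Proof.
move=> + u01; elim: s => [|rho s IH] s0.
  by rewrite !big_nil exp_0 /=.
have rho0 : 0 <= rho by apply: s0; rewrite mem_head.
rewrite !big_cons.
have {}IH := IH (fun r rs => s0 r (mem_behead (s := rho :: s) rs)).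
set P := (\prod_(i <- s) _)%R in IH *; set L := (\sum_(i <- s) _)%R in IH *.
set Q := (\prod_(i <- s) _)%R in IH *.
change ((1 + rho) * P * exp (log_chord rho u + L)
  = (1 - u) ^ (size s).+1 * (Rmax rho (u / (1 - u)) * Q)).
have -> : (1 + rho) * P * exp (log_chord rho u + L)
  = (1 + rho) * exp (log_chord rho u) * (P * exp L) by rewrite exp_plus; ring.
rewrite IH /log_chord exp_plus exp_Ropp !exp_ln; try lra; last first.
  by apply: Rlt_le_trans (Rmax_r _ _); lra.
have -> : Rmax (rho * (1 - u)) u = (1 - u) * Rmax rho (u / (1 - u)).
  by rewrite -RmaxRmult; [congr Rmax; field; lra | lra].
by rewrite /=; field; lra.
Qed.

(** In the application [g i] is the squared modulus of the i-th coefficient, [K] that of the leading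
    one, and [s] lists the squared moduli of the roots. The hypothesis at t = u/(1-u), multiplied by
    (1-u)^N, is integrated over [0, 1]. *)
Lemma exp_integral_bound (s : seq R) (g : nat -> R) (K : R) :
  (forall rho, rho \in s -> 0 <= rho) -> 0 <= K -> (forall i, 0 <= g i) ->
  (forall t, 0 < t -> K * (\prod_(rho <- s) Rmax rho t)%R
                      <= (\sum_(i < (size s).+1) g i * pow t i)%R) ->
  K * (\prod_(rho <- s) (1 + rho))%R * exp (- INR (size s)) * (INR (size s) + 1)
  <= (\sum_(i < (size s).+1) g i / Binomial.C (size s) i)%R.
Proof.
move=> s0 K0 g0 H; set N := size s in H *.
pose f i u := g i * (u ^ i * (1 - u) ^ (N - i)).
pose S u := (\sum_(i < N.+1) f i u)%R.
set T := (\sum_(i < N.+1) _)%R.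
have N0 := pos_INR N.
have IS : is_RInt S 0 1 (/ (INR N + 1) * T).
  pose v i := / (INR N + 1) * (g i / Binomial.C N i).
  have -> : / (INR N + 1) * T = (\sum_(i < N.+1) v i)%R.
    by rewrite /T RmultE big_distrr.
  refine (@is_RInt_bigsum N.+1 f v 0 1 _) => i li.
  rewrite /v.
  have -> : / (INR N + 1) * (g i / Binomial.C N i) = g i *
     (INR (fact i) * INR (fact (N - i)) / INR (fact (i + (N - i)).+1)).
    rewrite subnKC // fact_simpl mult_INR S_INR /Binomial.C.
    rewrite -[Nat.sub N i]/(N - i)%N.
    by field; repeat split; try exact: INR_fact_neq_0; lra.
  exact: (is_RInt_scal _ _ _ (g i) _ (@is_RInt_beta i (N - i))).
set P := (\prod_(rho <- s) _)%R; set I := / (INR N + 1) * T in IS.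
have P0 : 0 <= P.
  rewrite /P; elim: (s) s0 => [|r s' IH] s0; first by rewrite big_nil; apply: Rle_0_1.
  rewrite big_cons; apply: Rmult_le_pos.
    by apply: Rplus_le_le_0_compat; [exact: Rle_0_1 | apply: s0; rewrite mem_head].
  by apply: IH => x xs; apply: s0; rewrite inE xs orbT.
have sum_ge0 n (h : nat -> R) : (forall i, 0 <= h i) -> 0 <= (\sum_(i < n) h i)%R.
  move=> h0; elim: n => [|n IH]; first by rewrite big_ord0; apply: Rle_refl.
  by rewrite big_ord_recr; apply: Rplus_le_le_0_compat.
have S0 u : 0 < u < 1 -> 0 <= S u.
  move=> u01; apply: (sum_ge0 N.+1 (f^~ u)) => i; apply: Rmult_le_pos => //.
  by apply: Rmult_le_pos; apply: pow_le; lra.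
set B := K * P * exp (- INR N).
have B0 : 0 <= B by repeat apply: Rmult_le_pos => //; apply: Rlt_le; apply: exp_pos.
(* Jensen by the tangent line of exp at 0: the sum of the [log_chord] terms has integral -N, so the
   exponent N + L has mean zero. *)
have Sge u : 0 < u < 1 ->
    B * (1 + INR N + (\sum_(rho <- s) log_chord rho u)%R) <= S u.
  move=> u01; set L := (\sum_(rho <- s) _)%R.
  apply: (Rle_trans _ (B * exp (INR N + L))).
    apply: Rmult_le_compat_l => //; have := exp_ineq1_le (INR N + L); lra.
  have -> : B * exp (INR N + L) = K * (P * exp L).
    by rewrite /B exp_plus exp_Ropp; field; have := exp_pos (INR N); lra.
  rewrite prod_exp_log_chord // -/N.
  have t0 : 0 < u / (1 - u) by apply: Rdiv_lt_0_compat; lra.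
  have -> : S u = (1 - u) ^ N * (\sum_(i < N.+1) g i * pow (u / (1 - u)) i)%R.
    rewrite RmultE big_distrr /=; apply: eq_bigr => i _.
    have -> : (1 - u) ^ N = (1 - u) ^ i * (1 - u) ^ (N - i).
      by rewrite -pow_add; congr (_ ^ _); have := ltn_ord i; rewrite ltnS => /subnKC.
    rewrite /Rdiv Rpow_mult_distr pow_inv -!RmultE /f; field.
    by apply: pow_nonzero; lra.
  have := H _ t0; have := pow_le (1 - u) N; nra.
have [d [d0 Hd]] := is_RInt_sum_log_chord s0.
(* The logarithms may be singular at 0 and 1, so the comparison is made on [e, 1 - e]. The two end
   pieces of the integral of [S] are dropped because [S] is nonnegative. *)
have Hint e : 0 < e < Rmin d (1 / 2) -> B * (1 - 2 * (INR N + 1) * e) <= I.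
  move=> [e0 /Rmin_Rgt_l [ed e2]]; have [v iv vN] := Hd e (conj e0 ed).
  have i1 : is_RInt (fun u => B * ((1 + INR N) + (\sum_(rho <- s) log_chord rho u)%R))
      e (1 - e) (B * ((1 - e - e) * (1 + INR N) + v)).
    apply: is_RInt_scal; apply: is_RInt_plus iv; exact: is_RInt_const.
  have ex01 : ex_RInt S 0 1 by exists I.
  have exe1 : ex_RInt S e 1 by apply: ex_RInt_Chasles_2 ex01; lra.
  have exee : ex_RInt S e (1 - e) by apply: ex_RInt_Chasles_1 exe1; lra.
  have ex0e : ex_RInt S 0 e by apply: ex_RInt_Chasles_1 ex01; lra.
  have ex1 : ex_RInt S (1 - e) 1 by apply: ex_RInt_Chasles_2 exe1; lra.
  have E1 := RInt_Chasles _ _ _ _ ex0e exe1.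
  have E2 := RInt_Chasles _ _ _ _ exee ex1.
  rewrite /plus /= in E1 E2; rewrite (is_RInt_unique _ _ _ _ IS) in E1.
  have p1 : 0 <= RInt S 0 e by apply: RInt_ge_0 => // [|x ?]; [lra | apply: S0; lra].
  have p2 : 0 <= RInt S (1 - e) 1 by apply: RInt_ge_0 => // [|x ?]; [lra | apply: S0; lra].
  have le12 : e <= 1 - e by lra.
  have le3 := is_RInt_le _ _ _ _ _ _ le12 i1 (RInt_correct _ _ _ exee)
    (fun x (hx : e < x < 1 - e) => Sge x ltac:(lra)).
  have le4 : B * (1 - 2 * (INR N + 1) * e) <= B * ((1 - e - e) * (1 + INR N) + v).
    by apply: Rmult_le_compat_l => //; rewrite -/N in vN; lra.
  by lra.
have BI : B <= I.
  apply: Rnot_lt_le => IB.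
  have m0 : 0 < Rmin d (1 / 2) by apply: Rmin_glb_lt; lra.
  have D0 : 0 < 4 * (INR N + 1) * (B + 1) by nra.
  (* With this [e] the loss 2 (N+1) e B is at most (B - I) / 2, contradicting [Hint]. The [B + 1]
     keeps the denominator positive. *)
  pose e := Rmin (Rmin d (1 / 2) / 2) ((B - I) / (4 * (INR N + 1) * (B + 1))).
  have e0 : 0 < e.
    by apply: Rmin_glb_lt; [lra | apply: Rdiv_lt_0_compat; lra].
  have e1 : e <= Rmin d (1 / 2) / 2 by apply: Rmin_l.
  have e2 : e * (4 * (INR N + 1) * (B + 1)) <= B - I.
    by apply/Rle_div_r => //; apply: Rmin_r.
  have := Hint e ltac:(lra); nra.
have := Rmult_le_compat_r (INR N + 1) _ _ ltac:(lra) BI.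
have -> : I * (INR N + 1) = T by rewrite /I; field; lra.
by [].
Qed.

End LogIntegral.

Module BombieriNorm.

Import all_boot all_order all_algebra.
Import zify ring Rstruct complex.
Import LogIntegral.
Set Implicit Arguments. Unset Strict Implicit. Unset Printing Implicit Defensive.
Import Order.TTheory GRing.Theory Num.Theory.
Local Open Scope ring_scope.
Local Open Scope complex_scope.

(** * The Fischer norm of a product as a sum of squares *)

(* Contracting n = i - d = j - e factors of [x^i] with as many factors of [x^j]
   leaves [x^d] and [x^e]; the normalization is that of normal ordering. *)
Definition fischer_kernel (C : numClosedFieldType) (d e i j : nat) : C :=
  if (d <= i)%N && (i + e == j + d)%N then (i`! * j`!)%:R / (i - d)`!%:R else 0.

Lemma natr_fact_neq0 (C : numFieldType) n : n`!%:R != 0 :> C.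
Proof. by rewrite pnatr_eq0 -lt0n fact_gt0. Qed.

Lemma fischer_kernel_ge0 (C : numClosedFieldType) d e i j :
  0 <= fischer_kernel C d e i j.
Proof. by rewrite /fischer_kernel; case: ifP => // _; rewrite divr_ge0 ?ler0n. Qed.

(* The pairs (d, e) index the 2x2 matrices with row sums (i, j) and column sums
   (i', j'), so the sum is a Vandermonde convolution. *)
Lemma sum_fischer_kernel (C : numClosedFieldType) (D E i j i' j' : nat) :
  (i' <= D)%N -> (j' <= E)%N ->
  \sum_(y : 'I_D.+1 * 'I_E.+1)
     (y.1`! * y.2`!)%:R^-1 * (fischer_kernel C y.1 y.2 i j' * fischer_kernel C y.1 y.2 i' j)
  = if (i + j == i' + j')%N then (i + j)`!%:R else 0.
Proof.
move=> leD leE; case: eqP => [eqij | neij]; last first.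
  apply: big1 => -[d e] _ /=; rewrite /fischer_kernel.
  case: andP => [[_ /eqP e1]|]; last by rewrite mul0r mulr0.
  case: andP => [[_ /eqP e2]|]; last by rewrite !mulr0.
  by exfalso; lia.
rewrite -(pair_bigA _ (fun (d : 'I_D.+1) (e : 'I_E.+1) =>
  (d`! * e`!)%:R^-1 * (fischer_kernel C d e i j' * fischer_kernel C d e i' j))) /=.
(* For fixed [d] the kernels leave only e = j' + d - i. The cases where a binomial vanishes are
   those where no admissible [e] exists. *)
have inner (d : 'I_D.+1) : \sum_(e < E.+1) (d`! * e`!)%:R^-1 *
    (fischer_kernel C d e i j' * fischer_kernel C d e i' j)
  = if (d < i'.+1)%N then (i'`! * j'`! * ('C(i, d) * 'C(j, i' - d)))%:R else 0 :> C.
  have [ldi'|gdi'] := ltnP d i'.+1; last first.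
    apply: big1 => e _; rewrite /fischer_kernel [X in _ * X]mulrC leqNgt gdi' /=.
    by rewrite mul0r mulr0.
  have [ldi|gdi] := leqP d i; last first.
    rewrite bin_small // mul0n muln0; apply: big1 => e _.
    by rewrite /fischer_kernel leqNgt gdi /= mul0r mulr0.
  have [lid|gid] := leqP i (j' + d); last first.
    rewrite [X in (_ * X)%N]mulnC bin_small ?mul0n ?muln0; last by lia.
    apply: big1 => e _; rewrite /fischer_kernel.
    case: andP => [[_ /eqP e1]|]; last by rewrite mul0r mulr0.
    by exfalso; lia.
  have ltE : (j' + d - i < E.+1)%N by lia.
  rewrite (bigD1 (Ordinal ltE)) //= big1 ?addr0; last first.
    move=> e /negP ne; rewrite /fischer_kernel.
    case: andP => [[_ /eqP e1]|]; last by rewrite mul0r mulr0.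
    by case: ne; apply/eqP/val_inj => /=; lia.
  rewrite /fischer_kernel ldi -ltnS ldi' /=.
  have -> : (i + (j' + d - i) == j' + d)%N by lia.
  have -> : (i' + (j' + d - i) == j + d)%N by lia.
  have li'd : (i' - d <= j)%N by lia.
  have f1 := bin_fact ldi; have f2 := bin_fact li'd.
  have e2 : (j - (i' - d) = j' + d - i)%N by lia.
  rewrite -{1}f1 -{1}f2 e2 !natrM.
  by field; rewrite !natr_fact_neq0.
rewrite (eq_bigr _ (fun d _ => inner d)) -big_mkcond /=.
rewrite -(big_ord_widen D.+1 (fun d => (i'`! * j'`! * ('C(i, d) * 'C(j, i' - d)))%:R)) //=.
rewrite -natr_sum -big_distrr /= binomial.Vandermonde eqij.
rewrite [X in X%:R]mulnC -(bin_fact (leq_addr j' i')) addKn.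
by rewrite mulnA.
Qed.

(** Applied to both sides of the Fischer identity, this reduces it to comparing the coefficients of
    two Hermitian forms. A nonnegative kernel equals its own conjugate. *)
Lemma sum_norm_sqr_expand (C : numClosedFieldType) (X Y : finType) (w : Y -> C)
    (K : Y -> X -> C) (a : X -> C) :
  (forall y x, 0 <= K y x) ->
  \sum_y w y * `|\sum_x a x * K y x| ^+ 2
  = \sum_(u : X * X) a u.1 * (a u.2)^* * (\sum_y w y * (K y u.1 * K y u.2)).
Proof.
move=> K_ge0; transitivity (\sum_y \sum_(u : X * X)
   a u.1 * (a u.2)^* * (w y * (K y u.1 * K y u.2))).
  apply: eq_bigr => y _; rewrite normCK rmorph_sum big_distrlr /= pair_bigA /=.
  rewrite big_distrr /=; apply: eq_bigr => -[x x'] _ /=.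
  rewrite rmorphM /= (geC0_conj (K_ge0 y x')); ring.
by rewrite exchange_big /=; apply: eq_bigr => u _; rewrite big_distrr.
Qed.

(** The convolution is written with an indicator kernel so that [sum_norm_sqr_expand] applies to
    it. *)
Lemma coefM_pair (C : comNzRingType) (k l s : nat) (p q : {poly C}) :
  (size p <= k.+1)%N -> (size q <= l.+1)%N ->
  (p * q)`_s = \sum_(x : 'I_k.+1 * 'I_l.+1) p`_x.1 * q`_x.2 * (x.1 + x.2 == s)%N%:R.
Proof.
move=> sp sq; rewrite -(pair_bigA _ (fun (i : 'I_k.+1) (j : 'I_l.+1) =>
  p`_i * q`_j * (i + j == s)%N%:R)) /=.
have -> : \sum_(i < k.+1) \sum_(j < l.+1) p`_i * q`_j * (i + j == s)%N%:R
   = \sum_(i < k.+1) (if (i < s.+1)%N then p`_i * q`_(s - i) else 0).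
  apply: eq_bigr => i _; case: ltnP => [lis|gis]; last first.
    by apply: big1 => j _; rewrite (_ : (_ == _) = false) ?mulr0 //; lia.
  have [lsl|gsl] := ltnP (s - i) l.+1.
    rewrite (bigD1 (Ordinal lsl)) //= big1 ?addr0.
      by rewrite (_ : (_ == _) = true) ?mulr1 //; lia.
    move=> j /eqP ne; rewrite (_ : (_ == _) = false) ?mulr0 //.
    by apply/eqP => e; case: ne; apply/val_inj => /=; lia.
  rewrite [q`_(s - i)]nth_default ?(leq_trans sq) // mulr0.
  apply: big1 => j _; rewrite (_ : (_ == _) = false) ?mulr0 //.
  by have := ltn_ord j; lia.
rewrite -big_mkcond /= coefM.
rewrite (big_ord_widen (maxn k s).+1 (fun i => p`_i * q`_(s - i))) ?ltnS ?leq_maxr //.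
have := @big_ord_widen_cond _ 0 +%R k.+1 (maxn k s).+1 (fun i => (i < s.+1)%N)
   (fun i => p`_i * q`_(s - i)).
rewrite ltnS leq_maxl => -> //.
rewrite [RHS]big_mkcondr /=; apply: eq_bigr => i _; case: ltnP => // ki.
by rewrite nth_default ?mul0r // (leq_trans sp).
Qed.

Definition fischer (C : numClosedFieldType) (k : nat) (p : {poly C}) : C :=
  \sum_(i < k.+1) (i`! * (k - i)`!)%:R * `|p`_i| ^+ 2.

Lemma fischer_ge0 (C : numClosedFieldType) (k : nat) (p : {poly C}) : 0 <= fischer k p.
Proof. by apply: sumr_ge0 => i _; rewrite mulr_ge0 ?exprn_ge0 ?ler0n. Qed.

(** Normal ordering for the homogenized polynomials in two variables: [y.1] holds the exponents left
    uncontracted in the first variable, [y.2] those in the second. The coefficients factor over the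
    variables, and [sum_fischer_kernel] evaluates each factor. *)
Lemma fischer_mulE (C : numClosedFieldType) (k l : nat) (p q : {poly C}) :
  (size p <= k.+1)%N -> (size q <= l.+1)%N ->
  fischer (k + l) (p * q)
  = \sum_(y : ('I_k.+1 * 'I_l.+1) * ('I_k.+1 * 'I_l.+1))
     ((y.1.1`! * y.1.2`!)%:R^-1 * (y.2.1`! * y.2.2`!)%:R^-1) *
     `|\sum_(x : 'I_k.+1 * 'I_l.+1) p`_x.1 * (q`_x.2)^* *
        (fischer_kernel C y.1.1 y.1.2 x.1 x.2 *
         fischer_kernel C y.2.1 y.2.2 (k - x.1) (l - x.2))| ^+ 2.
Proof.
move=> sp sq; rewrite sum_norm_sqr_expand; last first.
  by move=> y x; rewrite mulr_ge0 ?fischer_kernel_ge0.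
have -> : fischer (k + l) (p * q) = \sum_(s < (k + l).+1) (s`! * (k + l - s)`!)%:R *
   `|\sum_(x : 'I_k.+1 * 'I_l.+1) p`_x.1 * q`_x.2 * (x.1 + x.2 == s)%N%:R| ^+ 2.
  by apply: eq_bigr => s _; rewrite (coefM_pair _ sp sq).
rewrite (sum_norm_sqr_expand (fun s : 'I_(k + l).+1 => (s`! * (k + l - s)`!)%:R : C)
  (K := fun (s : 'I_(k + l).+1) (x : 'I_k.+1 * 'I_l.+1) => (x.1 + x.2 == s)%N%:R : C)
  (fun x => p`_x.1 * q`_x.2)); last by move=> *; rewrite ler0n.
(* On the right [q] enters conjugated, on the left it does not; exchanging the two indices of [q]
   aligns the monomials. *)
pose swap (u : ('I_k.+1 * 'I_l.+1) * ('I_k.+1 * 'I_l.+1)) :=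
  ((u.1.1, u.2.2), (u.2.1, u.1.2)).
have swapK : involutive swap by case=> -[i j] [i' j'].
rewrite (reindex_inj (inv_inj swapK)) /=; apply: eq_bigr => -[[i j'] [i' j]] _ /=.
rewrite !rmorphM /= conjCK.
have -> : p`_i * q`_j * ((p`_i')^* * (q`_j')^*) =
  p`_i * (q`_j')^* * ((p`_i')^* * q`_j) by ring.
congr (_ * _); symmetry.
have li := ltn_ord i; have li' := ltn_ord i'.
have lj := ltn_ord j; have lj' := ltn_ord j'.
transitivity ((\sum_(y : 'I_k.+1 * 'I_l.+1) (y.1`! * y.2`!)%:R^-1 *
    (fischer_kernel C y.1 y.2 i j' * fischer_kernel C y.1 y.2 i' j)) *
  (\sum_(y : 'I_k.+1 * 'I_l.+1) (y.1`! * y.2`!)%:R^-1 *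
    (fischer_kernel C y.1 y.2 (k - i) (l - j') *
     fischer_kernel C y.1 y.2 (k - i') (l - j)))).
  rewrite big_distrlr pair_bigA /=; apply: eq_bigr => y _.
  by ring.
rewrite !sum_fischer_kernel ?leq_subr //; try by [rewrite -ltnS | lia].
case: eqP => [eqij | neij]; last first.
  rewrite mul0r big1 // => s _.
  by case: eqP => [e1|_]; case: eqP => [e2|_]; rewrite ?mul0r ?mulr0 //; lia.
have -> : (k - i + (l - j) == k - i' + (l - j'))%N by lia.
have ltn : (i + j < (k + l).+1)%N by lia.
rewrite (bigD1 (Ordinal ltn)) //= big1 ?addr0; last first.
  move=> s /eqP ne; rewrite (_ : (_ == _) = false) ?mul0r ?mulr0 //.
  by apply/eqP => e; case: ne; apply/val_inj.
rewrite eqij !eqxx !mulr1 -natrM -eqij; congr ((_ * _`!)%:R); lia.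
Qed.

Lemma fischer_mul_ge (C : numClosedFieldType) (k l : nat) (p q : {poly C}) :
  (size p <= k.+1)%N -> (size q <= l.+1)%N ->
  fischer k p * fischer l q <= fischer (k + l) (p * q).
Proof.
move=> sp sq; rewrite fischer_mulE //.
(* Keep only the terms without contraction. *)
set K := fun (y : ('I_k.+1 * 'I_l.+1) * ('I_k.+1 * 'I_l.+1)) (x : 'I_k.+1 * 'I_l.+1) =>
  fischer_kernel C y.1.1 y.1.2 x.1 x.2 * fischer_kernel C y.2.1 y.2.2 (k - x.1) (l - x.2).
rewrite -(pair_bigA _ (fun (y1 y2 : 'I_k.+1 * 'I_l.+1) =>
  ((y1.1`! * y1.2`!)%:R^-1 * (y2.1`! * y2.2`!)%:R^-1) *
  `|\sum_(x : 'I_k.+1 * 'I_l.+1) p`_x.1 * (q`_x.2)^* * K (y1, y2) x| ^+ 2)) /=.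
rewrite /fischer big_distrlr pair_bigA /=; apply: ler_sum => -[d e] _ /=.
(* The exponents k - d and l - e in the second variable complete [d] and [e] to the full degrees, so
   nothing is contracted. The kernels then require d <= i and k - d <= k - i, which leaves the
   single pair (d, e). *)
rewrite (bigD1 (rev_ord d, rev_ord e)) //= ler_wpDr //.
  by apply: sumr_ge0 => y _; rewrite mulr_ge0 ?exprn_ge0 // mulr_ge0 // invr_ge0 ler0n.
rewrite (bigD1 (d, e)) //= big1 ?addr0; last first.
  move=> -[i j] /eqP ne; rewrite /K /fischer_kernel /=.
  case: andP => [[le1 /eqP e1]|]; last by rewrite mul0r mulr0.
  case: andP => [[le2 /eqP e2]|]; last by rewrite !mulr0.
  have li := ltn_ord i; have ld := ltn_ord d.
  by case: ne; congr (_, _); apply/val_inj => /=; lia.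
rewrite /K /fischer_kernel /= !subSS !leqnn !subnn [(d + e)%N]addnC [(k - d + _)%N]addnC !eqxx fact0 !divr1.
rewrite !normrM norm_conjC !normr_nat.
rewrite !natrM le_eqVlt; apply/orP; left; apply/eqP.
by field; rewrite !natr_fact_neq0.
Qed.

(** * The Bombieri norm and multiplication by linear factors *)

Definition bw_sqr (C : numClosedFieldType) (k : nat) (p : {poly C}) : C :=
  \sum_(i < k.+1) `|p`_i| ^+ 2 / 'C(k, i)%:R.

Lemma fischerE (C : numClosedFieldType) (k : nat) (p : {poly C}) :
  fischer k p = k`!%:R * bw_sqr k p.
Proof.
rewrite /fischer /bw_sqr big_distrr /=; apply: eq_bigr => i _.
have lik : (i <= k)%N by rewrite -ltnS.
rewrite -(bin_fact lik) [in RHS]natrM.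
have : 'C(k, i)%:R != 0 :> C by rewrite pnatr_eq0 -lt0n bin_gt0.
by move=> ?; field.
Qed.

(** Two-term Cauchy-Schwarz: after the triangle inequality, the difference of the sides is (b|x| -
    a|y|)^2 / (a b (a+b)). *)
Lemma norm_sqrD_le (C : numClosedFieldType) (a b x y : C) : 0 < a -> 0 < b ->
  `|x + y| ^+ 2 / (a + b) <= `|x| ^+ 2 / a + `|y| ^+ 2 / b.
Proof.
move=> a0 b0; have ab0 : 0 < a + b by rewrite addr_gt0.
have le1 : `|x + y| ^+ 2 <= (`|x| + `|y|) ^+ 2.
  by rewrite lerXn2r ?nnegrE ?addr_ge0 ?normr_ge0 // ler_normD.
apply: le_trans (ler_wpM2r _ le1) _; first by rewrite invr_ge0 ltW.
rewrite -subr_ge0.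
have -> : `|x| ^+ 2 / a + `|y| ^+ 2 / b - (`|x| + `|y|) ^+ 2 / (a + b)
  = (b * `|x| - a * `|y|) ^+ 2 / (a * b * (a + b)).
  by field; rewrite !gt_eqF.
apply: divr_ge0; last by rewrite ltW // !mulr_gt0.
apply: real_exprn_even_ge0 => //.
by apply: rpredB; apply: rpredM; apply: ger0_real => //; apply: ltW.
Qed.

(** The factor 1 + |r|^2 is the squared norm of X - r. Pascal's rule splits each binomial of row k+1
    into two weights, to which [norm_sqrD_le] is applied coefficient by coefficient. *)
Lemma bw_sqr_mulXsubC (C : numClosedFieldType) (k : nat) (p : {poly C}) (r : C) :
  (size p <= k.+1)%N ->
  bw_sqr k.+1 (p * ('X - r%:P)) <= (1 + `|r| ^+ 2) * bw_sqr k p.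
Proof.
move=> sp; pose u i := if (i == 0)%N then 0 else `|p`_i.-1| ^+ 2 / 'C(k, i.-1)%:R : C.
pose v i := `|r| ^+ 2 * (`|p`_i| ^+ 2 / 'C(k, i)%:R) : C.
have -> : (1 + `|r| ^+ 2) * bw_sqr k p = \sum_(i < k.+2) (u i + v i).
  rewrite big_split mulrDl mul1r /=; congr (_ + _).
    by rewrite big_ord_recl add0r.
  rewrite big_ord_recr /= /v nth_default // normr0 expr0n mul0r mulr0 addr0.
  by rewrite /bw_sqr big_distrr.
apply: ler_sum => -[[|i] li] _ /=; rewrite mulrBr coefB coefMX coefMC /=.
  by rewrite /u /v !bin0 !divr1 !add0r normrN normrM exprMn mulrC.
rewrite /u /v /= binS natrD addrC mulrA -exprMn -normrM.
rewrite addrC [X in _ / X]addrC -(normrN (r * _)) mulrC [r * _]mulrC.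
(* At the top index C(k, k+1) = 0 is not a positive weight, but there p_(k+1) vanishes as well. *)
have [lik|gik] := ltnP i k.
  by rewrite mulrC; apply: norm_sqrD_le; rewrite ltr0n bin_gt0 // ltnW.
have -> : i = k by lia.
by rewrite [p`_k.+1]nth_default // mul0r !oppr0 normr0 addr0 binn bin_small // addr0 expr0n !mul0r addr0 mulrC.
Qed.

Lemma size_mul_prod_XsubC_le (C : comNzRingType) (q : {poly C}) (rs : seq C) n :
  (size q <= n.+1)%N ->
  (size (q * \prod_(r <- rs) ('X - r%:P))%R <= (n + size rs).+1)%N.
Proof.
move=> sq; apply: leq_trans (size_polyMleq _ _) _.
by rewrite size_prod_XsubC; lia.
Qed.

Lemma bw_sqr_prod_XsubC (C : numClosedFieldType) (c : C) (rs : seq C) :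
  bw_sqr (size rs) (c *: \prod_(r <- rs) ('X - r%:P))
  <= `|c| ^+ 2 * \prod_(r <- rs) (1 + `|r| ^+ 2).
Proof.
elim: rs => [|r rs IH] /=.
  by rewrite !big_nil mulr1 /bw_sqr big_ord1 bin0 divr1 alg_polyC coefC.
rewrite !big_cons -mul_polyC [X in _ * X]mulrC [X in bw_sqr _ X]mulrA.
apply: le_trans (bw_sqr_mulXsubC _ _) _.
  by apply: (@size_mul_prod_XsubC_le _ _ _ 0); rewrite size_polyC_leq1.
rewrite mul_polyC mulrCA; apply: ler_wpM2l => //.
by rewrite addr_ge0 ?exprn_ge0.
Qed.

(** * Landau's inequality on a circle *)

(* The mean of [|p|^2] over the circle [|z|^2 = t]. *)
Definition circle_sqr (C : numClosedFieldType) (n : nat) (t : C) (p : {poly C}) : C :=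
  \sum_(i < n.+1) `|p`_i| ^+ 2 * t ^+ i.

(* On [|z|^2 = t], [sqrt t * |z - r| = |t - r^* z|]. *)
Lemma circle_sqr_flip (C : numClosedFieldType) (n : nat) (t r : C) (q : {poly C}) :
  0 <= t -> (size q <= n.+1)%N ->
  t * circle_sqr n.+1 t (q * ('X - r%:P))
  = circle_sqr n.+1 t (q * (t%:P - r^* *: 'X)).
Proof.
(* The cross terms cancel, and the sides differ in degree i by w_i - w_(i+1). The sum telescopes to
   0, since [w] vanishes at 0 and at n + 2. *)
move=> t0 sq; pose w i := (if (i == 0)%N then 0 else `|q`_i.-1| ^+ 2) * t ^+ i * (t - `|r| ^+ 2).
apply/eqP; rewrite -subr_eq0 /circle_sqr big_distrr -sumrB /=.
rewrite (eq_bigr (fun i : 'I_n.+2 => - (w i.+1 - w i))); last first.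
  move=> -[i /= _] _; rewrite !mulrBr !coefB -scalerAr !coefZ coefMX !coefMC /w /=.
  rewrite !normCK !(rmorphB, rmorphM) /= conjCK (geC0_conj t0) exprS.
  by case: (i == 0)%N; rewrite ?conjC0 ?normCK; ring.
rewrite -(big_mkord xpredT (fun i => - (w i.+1 - w i))) sumrN.
by rewrite telescope_sumr // /w /= nth_default // normr0 expr0n !mul0r subr0 oppr0.
Qed.

(* Landau: flip the factors with [|r|^2 > t], then bound by the leading coefficient. *)
Lemma circle_sqr_ge (C : numClosedFieldType) (rs : seq C) (n : nat) (t : C) (q : {poly C}) :
  0 < t -> (size q <= n.+1)%N ->
  `|q`_n| ^+ 2 * t ^+ n * \prod_(r <- rs) Num.max t (`|r| ^+ 2)
  <= circle_sqr (n + size rs) t (q * \prod_(r <- rs) ('X - r%:P)).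
Proof.
(* Generalizing over [q] lets the induction absorb each factor into it, flipped or not. *)
move=> t0; elim: rs n q => [|r rs IH] n q sq.
  rewrite !big_nil !mulr1 addn0 /circle_sqr big_ord_recr /= lerDr.
  by apply: sumr_ge0 => i _; rewrite mulr_ge0 ?exprn_ge0 // ltW.
have szl (s : {poly C}) : (size s <= 2)%N -> (size (q * s)%R <= n.+2)%N.
  by move=> ss; apply: leq_trans (size_polyMleq _ _) _; lia.
have q0 : q`_n.+1 = 0 by rewrite nth_default.
rewrite !big_cons /= addnS -addSn [Num.max t (`|r| ^+ 2)]/Order.max; case: ifP => _; last first.
  rewrite [q * (_ * _)]mulrA; apply: le_trans (IH n.+1 _ (szl _ (eq_leq (size_XsubC r)))).
  rewrite mulrBr coefB coefMX coefMC q0 mul0r subr0 /=.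
  by rewrite [t ^+ n.+1]exprS le_eqVlt; apply/orP; left; apply/eqP; ring.
(* The flipped factor multiplies the leading coefficient by -conj(r), which supplies |r|^2; the
   factor [t] on the left becomes the extra power of [t]. *)
have st : (size (t%:P - r^* *: 'X)%R <= 2)%N.
  apply: leq_trans (size_polyD _ _) _.
  rewrite geq_max (leq_trans (size_polyC_leq1 _)) // size_polyN.
  by apply: leq_trans (size_scale_leq _ _) _; rewrite size_polyX.
rewrite -(ler_pM2l t0) [('X - r%:P) * _]mulrC [q * (_ * _)]mulrA addSn.
rewrite circle_sqr_flip ?(ltW t0) ?size_mul_prod_XsubC_le // [q * _ * _]mulrAC.
apply: le_trans (IH n.+1 _ (szl _ st)).
rewrite mulrBr coefB -scalerAr coefZ coefMX coefMC q0 mul0r sub0r normrN /=.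
by rewrite normrM norm_conjC exprMn [t ^+ n.+1]exprS le_eqVlt; apply/orP; left; apply/eqP; ring.
Qed.

(** * From coefficient lists to polynomials over the complex numbers *)

Definition complex_of_Cpx (z : Cpx) : R[i] := Complex z.1 z.2.

Definition poly_of_cpoly (p : cpoly) : {poly R[i]} := Poly [seq complex_of_Cpx z | z <- p].

Definition sqr_modulus (z : R[i]) : R := complex.Re z ^+ 2 + complex.Im z ^+ 2.

Definition bw_sum (p : cpoly) : R :=
  sum_f_R0 (fun i => Rdiv (Cnorm2 (coef p i)) (Binomial.C (deg p) i)) (deg p).

Lemma sqr_modulusE (z : R[i]) : (sqr_modulus z)%:C = `|z| ^+ 2.
Proof. exact: add_Re2_Im2. Qed.

Lemma sqr_modulus_ge0 (z : R[i]) : 0 <= sqr_modulus z.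
Proof. by rewrite addr_ge0 ?sqr_ge0. Qed.

Lemma nth_seqE (T : Type) (x : T) (s : seq T) i : List.nth i s x = seq.nth x s i.
Proof. by elim: s i => [|y s IH] [|i] /=. Qed.

Lemma coef_poly_of_cpoly (p : cpoly) i : (poly_of_cpoly p)`_i = complex_of_Cpx (coef p i).
Proof. by rewrite coef_Poly /coef nth_seqE; elim: p i => [|z p IH] [|i] //=. Qed.

Lemma size_poly_of_cpoly (p : cpoly) : (size (poly_of_cpoly p) <= size p)%N.
Proof. by rewrite (leq_trans (size_Poly _)) ?size_map. Qed.

Lemma complex_of_CsumE (f : nat -> Cpx) n :
  complex_of_Cpx (Csum f n) = \sum_(i < n) complex_of_Cpx (f i).
Proof. by elim: n => [|n IH]; rewrite ?big_ord0 ?big_ord_recr //= -IH. Qed.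

Lemma size_pmul (p q : cpoly) : size (pmul p q) = (size p + size q - 1)%N.
Proof. by rewrite -[LHS]/(length _) length_map length_seq. Qed.

Lemma poly_of_pmul (p q : cpoly) :
  poly_of_cpoly (pmul p q) = poly_of_cpoly p * poly_of_cpoly q.
Proof.
apply/polyP => i; rewrite coef_poly_of_cpoly.
have [lti|gei] := ltnP i (size p + size q - 1).
  (* The new default is the mapped function at 0, the form that [map_nth] expects. *)
  rewrite coefM /coef /pmul (nth_indep _ _ (Csum (fun j => Cmul (coef p j) (coef q (0 - j))) 1)).
    rewrite (map_nth (fun n => Csum (fun j => Cmul (coef p j) (coef q (n - j))) n.+1)).
    rewrite seq_nth; last exact/ssrnat.ltP.
    rewrite complex_of_CsumE; apply: eq_bigr => j _.
    by rewrite !coef_poly_of_cpoly.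
  by rewrite length_map length_seq; apply/ssrnat.ltP.
rewrite /coef nth_seqE nth_default ?size_pmul // [RHS]nth_default //.
apply: leq_trans (size_polyMleq _ _) (leq_trans _ gei).
by have := size_poly_of_cpoly p; have := size_poly_of_cpoly q; lia.
Qed.

Lemma binomial_CE n i : (i <= n)%N -> Binomial.C n i = 'C(n, i)%:R.
Proof.
move=> le_in; rewrite /Binomial.C -[Nat.sub n i]/(n - i)%N !INRE !factE RdivE RmultE.
by rewrite -(bin_fact le_in) natrM -[X in _ / X]natrM mulfK // pnatr_eq0 -lt0n muln_gt0 !fact_gt0.
Qed.

Lemma bw_sumE (p : cpoly) : (bw_sum p)%:C = bw_sqr (deg p) (poly_of_cpoly p).
Proof.
rewrite /bw_sum sum_f_R0E big_mkord rmorph_sum /=; apply: eq_bigr => i _.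
rewrite RdivE binomial_CE; last by rewrite -ltnS.
by rewrite fmorph_div rmorph_nat coef_poly_of_cpoly -sqr_modulusE /sqr_modulus !expr2.
Qed.

Lemma bw_sum_ge0 (p : cpoly) : 0 <= bw_sum p.
Proof.
rewrite -ler0c bw_sumE; apply: sumr_ge0 => i _.
by rewrite divr_ge0 ?exprn_ge0 ?ler0n.
Qed.

Lemma factor_of_size (k : nat) (p : {poly R[i]}) : p`_k != 0 -> (size p <= k.+1)%N ->
  exists c rs, p = c *: \prod_(r <- rs) ('X - r%:P) /\ size rs = k.
Proof.
move=> pk sp; have [rs prs] := closed_field_poly_normal p.
exists (lead_coef p), rs; split => //.
have szp : size p = k.+1.
  by apply/eqP; rewrite eqn_leq sp ltnNge; apply: contraNN pk => /(nth_default 0)->.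
have c0 : lead_coef p != 0 by rewrite lead_coef_eq0 -size_poly_eq0 szp.
by apply: succn_inj; rewrite -szp [in RHS]prs size_scale // size_prod_XsubC.
Qed.

Lemma size_nonzero_lead (p : cpoly) : has_nonzero_lead p -> size p = (deg p).+1.
Proof.
move=> [p0 _]; have : size p != 0%N by apply/eqP => /size0nil.
by rewrite /deg -[length _]/(size _); lia.
Qed.

(** [deg] reads the length of a list, so the degree of the product follows by counting entries. *)
Lemma size_pprod (P : nat -> cpoly) (l : seq nat) : (forall j, j \in l -> has_nonzero_lead (P j)) ->
  size (fold_right (fun i acc => pmul (P i) acc) [:: Cone] l) =
  (\sum_(j <- l) deg (P j)).+1.
Proof.
elim: l => [|j l IH] hl; first by rewrite big_nil.
rewrite big_cons /= size_pmul IH; last by move=> i il; apply: hl; rewrite inE il orbT.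
by rewrite (size_nonzero_lead (hl j (mem_head _ _))); lia.
Qed.

Lemma poly_of_pprod (P : nat -> cpoly) (l : seq nat) :
  poly_of_cpoly (fold_right (fun i acc => pmul (P i) acc) [:: Cone] l)
  = \prod_(j <- l) poly_of_cpoly (P j).
Proof.
elim: l => [|j l IH]; last by rewrite big_cons /= poly_of_pmul IH.
rewrite big_nil; apply/polyP => -[|i]; rewrite coef_poly_of_cpoly coef1 //.
by rewrite /coef nth_seqE nth_default.
Qed.

Lemma coef_deg_neq0 (p : cpoly) : has_nonzero_lead p -> (poly_of_cpoly p)`_(deg p) != 0.
Proof.
move=> hp; have sp := size_nonzero_lead hp; have [_ lp] := hp.
rewrite coef_poly_of_cpoly; apply/eqP => -[z1 z2]; apply: lp.
have -> : List.last p Czero = coef p (deg p).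
  rewrite /coef nth_seqE; have -> : deg p = (size p).-1 by rewrite sp.
  by rewrite nth_last; case: (p) => // x s; elim: s x => //= y s IH x; rewrite -IH.
by rewrite [LHS]surjective_pairing z1 z2.
Qed.

(** * The two bounds for squared norms *)

Lemma prod_fischer_le (P : nat -> cpoly) (l : seq nat) : (forall j, j \in l -> has_nonzero_lead (P j)) ->
  \prod_(j <- l) fischer (deg (P j)) (poly_of_cpoly (P j))
  <= fischer (\sum_(j <- l) deg (P j)) (\prod_(j <- l) poly_of_cpoly (P j)).
Proof.
elim: l => [|j l IH] hl.
  by rewrite !big_nil /fischer big_ord1 coef1 normr1 expr1n mulr1.
have hl' i : i \in l -> has_nonzero_lead (P i) by move=> il; apply: hl; rewrite inE il orbT.
rewrite !big_cons; apply: le_trans (ler_wpM2l (fischer_ge0 _ _) (IH hl')) _.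
apply: fischer_mul_ge.
  by rewrite (leq_trans (size_poly_of_cpoly _)) // size_nonzero_lead //; apply: hl; rewrite mem_head.
by rewrite -poly_of_pprod (leq_trans (size_poly_of_cpoly _)) // size_pprod.
Qed.

(** Concatenating the root lists of the factors gives that of the product. The second bound thereby
    becomes a lower bound for the norm of one polynomial in terms of its roots. *)
Lemma prod_bw_sqr_le_roots (P : nat -> cpoly) (l : seq nat) : (forall j, j \in l -> has_nonzero_lead (P j)) ->
  exists c rs, [/\ \prod_(j <- l) poly_of_cpoly (P j) = c *: \prod_(r <- rs) ('X - r%:P),
    size rs = (\sum_(j <- l) deg (P j))%N
    & \prod_(j <- l) bw_sqr (deg (P j)) (poly_of_cpoly (P j))
      <= `|c| ^+ 2 * \prod_(r <- rs) (1 + `|r| ^+ 2)].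
Proof.
elim: l => [|j l IH] hl.
  by exists 1, [::]; rewrite !big_nil scale1r normr1 expr1n mulr1.
have [|c [rs [e1 e2 e3]]] := IH; first by move=> i il; apply: hl; rewrite inE il orbT.
have hj := hl j (mem_head _ _).
have [|c' [rs' [e1' e2']]] := factor_of_size (coef_deg_neq0 hj).
  by rewrite (leq_trans (size_poly_of_cpoly _)) // size_nonzero_lead.
exists (c' * c), (rs' ++ rs); split.
- by rewrite big_cons e1 e1' big_cat /= -scalerAl -scalerAr scalerA.
- by rewrite size_cat big_cons e2 e2'.
rewrite big_cons big_cat /= normrM exprMn mulrACA; apply: ler_pM => //.
- by rewrite -bw_sumE ler0c bw_sum_ge0.
- apply: prodr_ge0 => i _; rewrite -bw_sumE ler0c; exact: bw_sum_ge0.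
by rewrite -e2' e1'; apply: bw_sqr_prod_XsubC.
Qed.

Lemma deg_pprod (P : nat -> cpoly) (l : seq nat) :
  (forall j, j \in l -> has_nonzero_lead (P j)) ->
  deg (fold_right (fun i acc => pmul (P i) acc) [:: Cone] l) = (\sum_(j <- l) deg (P j))%N.
Proof. by move=> hl; rewrite -[LHS]/(size _ - 1)%N size_pprod // subn1. Qed.

Lemma prod_bw_sum_le_fact (P : nat -> cpoly) (l : seq nat) :
  (forall j, j \in l -> has_nonzero_lead (P j)) ->
  (\prod_(j <- l) (deg (P j))`!%:R) * \prod_(j <- l) bw_sum (P j)
  <= (\sum_(j <- l) deg (P j))`!%:R
     * bw_sum (fold_right (fun i acc => pmul (P i) acc) [:: Cone] l).
Proof.
move=> hl; rewrite -lecR !rmorphM !rmorph_prod /= bw_sumE deg_pprod // poly_of_pprod.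
rewrite rmorph_nat -fischerE -big_split /=; apply: le_trans (prod_fischer_le hl).
rewrite le_eqVlt; apply/orP; left; apply/eqP; apply: eq_bigr => j _.
by rewrite rmorph_nat fischerE bw_sumE.
Qed.

Lemma prod_bw_sum_le_exp (P : nat -> cpoly) (l : seq nat) :
  (forall j, j \in l -> has_nonzero_lead (P j)) ->
  (\prod_(j <- l) bw_sum (P j)) * ((\sum_(j <- l) deg (P j))%:R + 1)
  <= exp (\sum_(j <- l) deg (P j))%:R
     * bw_sum (fold_right (fun i acc => pmul (P i) acc) [:: Cone] l).
Proof.
move=> hl; have [c [rs [eP szrs le_roots]]] := prod_bw_sqr_le_roots hl.
set N := (\sum_(j <- l) _)%N in szrs *; set B := bw_sum (fold_right _ _ _).
pose s := [seq sqr_modulus r | r <- rs].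
pose Q := c *: \prod_(r <- rs) ('X - r%:P).
have szs : size s = N by rewrite size_map.
have BE : B = \sum_(i < N.+1) Rdiv (sqr_modulus Q`_i) (Binomial.C N i).
  apply: complexI; rewrite bw_sumE deg_pprod // poly_of_pprod eP rmorph_sum.
  apply: eq_bigr => i _; rewrite RdivE binomial_CE; last by rewrite -ltnS.
  by rewrite fmorph_div rmorph_nat /= sqr_modulusE.
(* Landau's inequality started from the constant polynomial [c], with n = 0. *)
have circle t : Rlt 0 t -> Rle (Rmult (sqr_modulus c) (\prod_(rho <- s) Rmax rho t))
    (\sum_(i < (size s).+1) sqr_modulus Q`_i * pow t i).
  move=> /RltP t0; apply/RleP; rewrite RmultE szs -lecR rmorphM rmorph_prod rmorph_sum /=.
  have tC0 : 0 < t%:C by rewrite (ltcR 0 t).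
  have := circle_sqr_ge rs tC0 (size_polyC_leq1 c).
  rewrite coefC eqxx expr0 mulr1 add0n szrs mul_polyC big_map sqr_modulusE.
  congr (_ * _ <= _).
    apply: eq_bigr => r _; rewrite RmaxE maxC -sqr_modulusE /Order.max ltcR.
    by case: ifP.
  by apply: eq_bigr => i _; rewrite rmorphM /= RpowE rmorphXn /= sqr_modulusE.
have s0 rho : rho \in s -> Rle 0 rho.
  by case/mapP => r _ ->; apply/RleP/sqr_modulus_ge0.
have := exp_integral_bound s0 (RleP (sqr_modulus_ge0 c))
  (fun i => RleP (sqr_modulus_ge0 Q`_i)) circle.
rewrite szs => /RleP; rewrite !RmultE INRE -BE exp_Ropp RinvE => le_B.
have e0 : 0 < exp N%:R by apply/RltP; apply: exp_pos.
rewrite mulrAC ler_pdivrMr // [B * _]mulrC in le_B.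
apply: le_trans le_B; apply: ler_wpM2r; first by rewrite addr_ge0 ?ler0n.
rewrite -lecR rmorph_prod /= rmorphM /= rmorph_prod sqr_modulusE big_map.
under eq_bigr => j _ do rewrite bw_sumE.
apply: le_trans le_roots _; rewrite le_eqVlt; apply/orP; left; apply/eqP; congr (_ * _).
by apply: eq_bigr => r _; rewrite rmorphD rmorph1 /= sqr_modulusE.
Qed.

(** * Square roots and the minimum of the two bounds *)

Lemma In_mem (l : seq nat) j : j \in l -> List.In j l.
Proof. by elim: l => //= i l IH; rewrite inE => /orP[/eqP->|/IH]; [left | right]. Qed.

Lemma fold_right_prod (f : nat -> R) (l : seq nat) :
  fold_right (fun i acc => Rmult (f i) acc) 1%R l = \prod_(i <- l) f i.
Proof. by elim: l => [|i l IH]; rewrite ?big_nil ?big_cons //= IH. Qed.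

Lemma fold_right_sum (f : nat -> nat) (l : seq nat) :
  fold_right (fun i acc => Nat.add (f i) acc) 0%N l = (\sum_(i <- l) f i)%N.
Proof. by elim: l => [|i l IH]; rewrite ?big_nil ?big_cons //= IH. Qed.

Lemma prod_bw_norm (P : nat -> cpoly) (l : seq nat) :
  \prod_(j <- l) bw_norm (P j) = R_sqrt.sqrt (\prod_(j <- l) bw_sum (P j)).
Proof.
elim: l => [|j l IH]; first by rewrite !big_nil sqrt_1.
by rewrite !big_cons IH -RmultE sqrt_mult_alt //; apply/RleP/bw_sum_ge0.
Qed.

Lemma prod_bw_norm_le (P : nat -> cpoly) (l : seq nat) :
  (forall j, List.In j l -> has_nonzero_lead (P j)) ->
  let N := fold_right (fun i acc => Nat.add (deg (P i)) acc) 0%N l in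
  Rle (fold_right (fun i acc => Rmult (bw_norm (P i)) acc) 1%R l)
    (Rmult
      (Rmin
        (R_sqrt.sqrt (Rdiv (INR (fact N))
           (fold_right (fun i acc => Rmult (INR (fact (deg (P i)))) acc) 1%R l)))
        (R_sqrt.sqrt (Rdiv (exp (INR N)) (Rplus (INR N) 1%R))))
      (bw_norm (fold_right (fun i acc => pmul (P i) acc) [:: Cone] l))).
Proof.
move=> hl N; have hl' j (jl : j \in l) := hl j (In_mem jl).
have NE : N = (\sum_(j <- l) deg (P j))%N := fold_right_sum _ _.
rewrite (fold_right_prod (fun i => bw_norm (P i))) prod_bw_norm.
rewrite (fold_right_prod (fun i => INR (fact (deg (P i))))).
set Q := fold_right _ [:: Cone] l.
(* Both constants have the form sqrt(a / d), so each case reduces to a division-free inequality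
   between squared norms. *)
have le_sqrt (a d : R) : 0 < a -> 0 < d ->
    \prod_(j <- l) bw_sum (P j) * d <= a * bw_sum Q ->
    Rle (R_sqrt.sqrt (\prod_(j <- l) bw_sum (P j)))
        (Rmult (R_sqrt.sqrt (Rdiv a d)) (bw_norm Q)).
  move=> a0 d0 le_ad; rewrite -[bw_norm Q]/(R_sqrt.sqrt (bw_sum Q)) -sqrt_mult_alt; last first.
    by apply/RleP; rewrite RdivE divr_ge0 ?ltW.
  apply: sqrt_le_1_alt; apply/RleP.
  by rewrite RdivE RmultE mulrAC ler_pdivlMr.
rewrite RminE /Order.min; case: ifP => _; apply: le_sqrt.
- by rewrite INRE factE ltr0n fact_gt0.
- by apply: prodr_gt0 => j _; rewrite INRE factE ltr0n fact_gt0.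
- rewrite INRE factE NE mulrC; apply: le_trans (prod_bw_sum_le_fact hl').
  by rewrite le_eqVlt; apply/orP; left; apply/eqP; congr (_ * _);
    apply: eq_bigr => j _; rewrite INRE factE.
- by apply/RltP; apply: exp_pos.
- by rewrite RplusE INRE ltr_wpDl ?ler0n ?ltr01.
- by rewrite RplusE INRE NE; apply: prod_bw_sum_le_exp.
Qed.

End BombieriNorm.

Theorem theorem5p1 (m : nat) (P : nat -> cpoly) :
  (forall j, (j < m)%nat -> has_nonzero_lead (P j) /\ (1 <= deg (P j))%nat) ->
  let N := nsum (fun j => deg (P j)) m in
  Rprod (fun j => bw_norm (P j)) m <=
    Rmin (sqrt (INR (fact N) / Rprod (fun j => INR (fact (deg (P j)))) m))
         (sqrt (exp (INR N) / (INR N + 1)))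
    * bw_norm (pprod P m).
Proof.
  intros H; apply BombieriNorm.prod_bw_norm_le; intros j Hj.
  apply in_seq in Hj; destruct Hj as [_ Hj]; exact (proj1 (H j Hj)).
Qed.
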